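(* Let $K\ge 2$ be an integer and let $\eta=\eta(T)>0$ and $\gamma=\gamma(T)\in(0,1]$ be arbitrary functions of the number of rounds $T$. Then there exists an adaptive cost schedule (one for each $T$) such that, when the Exp3 algorithm with exploration probability $\gamma(T)$ and sensitivity $\eta(T)$ plays the $K$-armed bandit for $T$ rounds against it, its regret $R$ satisfies $$\mathbf{E}(R)=\Omega(T^{2/3}),$$ i.e. there are $c>0$ and $T_0$ such that $\mathbf{E}(R)\ge cT^{2/3}$ for all $T\ge T_0$.
   Context: Game. A gambler and an adversary play $T$ rounds. In round $t$ the gambler chooses an arm $M^t\in\{1,\dots,K\}$ while the adversary simultaneously chooses costs $c^t_1,\dots,c^t_K\in[0,1]$; the gambler then observes only $c^t_{M^t}$, and the adversary learns $M^t$. An adaptive cost schedule is a rule specifying, for each $t\le T$, the cost vector $c^t=(c^t_1,\dots,c^t_K)$ as a function of the previous choices $M^1,\dots,M^{t-1}$ of the gambler; the schedule may depend on the gambler's algorithm, but the gambler's randomization in round $t$ is independent of $c^t$ given the past. The regret is $$R=\sum_{t=1}^T c^t_{M^t}-\min_{1\le j\le K}\sum_{t=1}^T c^t_j .$$ Exp3 with exploration probability $\gamma$ and sensitivity $\eta$ (cost version). Maintain weights $w_1,\dots,w_K$, all initialized to $1$. In each round $t$: set $p_j=(1-\gamma)\,w_j/\sum_{\ell=1}^K w_\ell+\gamma/K$ for every $j$; sample $M=M^t$ according to $(p_1,\dots,p_K)$ with fresh randomness; observe and incur the cost $c^t_M$; replace $w_M$ by $w_M\exp(-\eta\, c^t_M/p_M)$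 and leave all other weights unchanged. *)

(* Defs.v *)
From HB Require Import structures.
From mathcomp Require Import all_boot all_order all_algebra.
From mathcomp Require Import all_classical all_reals all_analysis.

Set Implicit Arguments.
Unset Strict Implicit.
Unset Printing Implicit Defensive.

Import Order.TTheory GRing.Theory Num.Theory.

Local Open Scope ring_scope.

(* A history is the list of the gambler's past choices, MOST RECENT FIRST:
   after t rounds it is [:: M^t; ...; M^1].  Hence, in M :: h, the arm M is
   played in the round whose past is h. *)
Definition history (K : nat) := seq 'I_K.

(* c h j is the cost of arm j in round (size h).+1 when the past is h. *)
Definition schedule (R : realType) (K : nat) := history K -> 'I_K -> R.

Definition cost_schedule (R : realType) (K : nat) (c : schedule R K) : Prop :=
  forall h j, 0 <= c h j <= 1.

Fixpoint gambler_cost (R : realType) (K : nat) (c : schedule R K)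
    (h : history K) : R :=
  if h is M :: h' then gambler_cost c h' + c h' M else 0.

Fixpoint arm_cost (R : realType) (K : nat) (c : schedule R K) (j : 'I_K)
    (h : history K) : R :=
  if h is _ :: h' then arm_cost c j h' + c h' j else 0.

(* The infimum is over the finite set of arms, nonempty for 0 < K, hence it is
   the minimum. *)
Definition regret (R : realType) (K : nat) (c : schedule R K)
    (h : history K) : R :=
  gambler_cost c h - inf (range (fun j : 'I_K => arm_cost c j h)).

Definition exp3_prob (R : realType) (K : nat) (gamma : R) (w : 'I_K -> R)
    (j : 'I_K) : R :=
  (1 - gamma) * w j / (\sum_(l < K) w l) + gamma / K%:R.

Definition exp3_update (R : realType) (K : nat) (gamma eta : R)
    (w : 'I_K -> R) (M : 'I_K) (cost : R) : 'I_K -> R :=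
  fun j => if j == M then w M * expR (- eta * cost / exp3_prob gamma w M)
           else w j.

Fixpoint exp3_weights (R : realType) (K : nat) (gamma eta : R)
    (c : schedule R K) (h : history K) : 'I_K -> R :=
  if h is M :: h' then
    exp3_update gamma eta (exp3_weights gamma eta c h') M (c h' M)
  else fun=> 1.

(* Probability that the first (size h) choices of Exp3 against c are h: the
   product of the conditional probabilities of each choice given its past. *)
Fixpoint exp3_law (R : realType) (K : nat) (gamma eta : R)
    (c : schedule R K) (h : history K) : R :=
  if h is M :: h' then
    exp3_law gamma eta c h' * exp3_prob gamma (exp3_weights gamma eta c h') M
  else 1.

Definition exp3_expected_regret (R : realType) (K : nat) (gamma eta : R)
    (c : schedule R K) (T : nat) : R :=
  \sum_(h : T.-tuple 'I_K) exp3_law gamma eta c h * regret c h.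

(* Main.v *)
(* The adversary exploits the noise of Exp3's own cost estimates (the observed
   cost divided by the probability of playing the arm).

   If gamma >= const * T^(-1/3), exploration alone costs gamma * T; if
   eta <= T^(-2/3), learning that one arm is bad takes about 1 / eta rounds.  In
   both cases constant costs suffice.

   Otherwise put T = u^6 and A = u^4 = T^(2/3).  The quantity
   Q = (ln K - ln (sum of the weights)) / eta is a supermartingale relative to the
   gambler's cost up to gamma * T <= small * A, so it suffices to make
   E (Q - min_j C_j) of order A, where C_j is the true cost of arm j.  First only
   the arm i1 is charged.  Its probability p drops to O(u^(-2)), after which
   (estimated cost) - (true cost) of i1 is a martingale whose variance grows by
   1/p - 1 per round, so within O(T) rounds it exceeds A with probability bounded
   below.  When this happens, all arms but i1 are charged until the end: the
   other estimates catch up with that of i1, hence Q ends up near the estimated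
   cost of i1, which exceeds its true cost by A.  When it does not happen, nothing
   is charged any more and the regret term is nonnegative, since the best arm has
   cost 0. *)
Require Import Defs.
From HB Require Import structures.
From mathcomp Require Import all_boot all_order all_algebra.
From mathcomp Require Import all_classical all_reals all_analysis.
From mathcomp Require Import ring lra.

Set Implicit Arguments.
Unset Strict Implicit.
Unset Printing Implicit Defensive.

Import Order.TTheory GRing.Theory Num.Theory.

Local Open Scope ring_scope.

(** * The law of the play, and preliminary inequalities *)

Lemma sum_tuple_cons (R : realType) (I : finType) n (F : seq I -> R) :
  \sum_(h : n.+1.-tuple I) F h = \sum_(h : n.-tuple I) \sum_(M : I) F (M :: h).
Proof.
rewrite pair_big /=.
rewrite (reindex (fun q : n.-tuple I * I => cons_tuple q.2 q.1)) //=.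
exists (fun t : n.+1.-tuple I => (behead_tuple t, thead t)).
  by move=> [h M] _ /=; congr (_, _); apply: val_inj.
by move=> t _; rewrite [RHS]tuple_eta; apply: val_inj.
Qed.

Section Law.
Context (R : realType) (K : nat) (gamma eta : R) (c : schedule R K).
Hypotheses (K_gt0 : (0 < K)%N) (gamma01 : 0 < gamma <= 1).

Lemma exp3_prob_ge (w : 'I_K -> R) j : (forall l, 0 <= w l) ->
  gamma / K%:R <= exp3_prob gamma w j.
Proof.
move=> w0; rewrite /exp3_prob lerDr divr_ge0 ?mulr_ge0 ?sumr_ge0 //.
by case/andP: gamma01; rewrite subr_ge0.
Qed.

Lemma exp3_prob_gt0 (w : 'I_K -> R) j : (forall l, 0 <= w l) ->
  0 < exp3_prob gamma w j.
Proof.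
move=> w0; apply: lt_le_trans (exp3_prob_ge j w0).
by case/andP: gamma01 => g0 _; rewrite divr_gt0 ?ltr0n.
Qed.

Lemma exp3_prob_sum (w : 'I_K -> R) : (forall l, 0 < w l) ->
  \sum_j exp3_prob gamma w j = 1.
Proof.
move=> w0; have W0 : 0 < \sum_l w l.
  by rewrite (bigD1 (Ordinal K_gt0)) //= ltr_pwDl // sumr_ge0 // => i _; exact: ltW.
rewrite big_split /= -mulr_suml -mulr_sumr mulfK ?gt_eqF //.
rewrite sumr_const card_ord -[_ / _ *+ _]mulr_natr divfK ?subrK //.
by rewrite pnatr_eq0 -lt0n.
Qed.

Lemma exp3_weights_gt0 h j : 0 < exp3_weights gamma eta c h j.
Proof.
elim: h j => [|M h IH] j /=; first exact: ltr01.
by rewrite /exp3_update; case: ifP => _ //; rewrite mulr_gt0 ?expR_gt0.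
Qed.

Lemma exp3_law_ge0 h : 0 <= exp3_law gamma eta c h.
Proof.
elim: h => [|M h IH] /=; first exact: ler01.
rewrite mulr_ge0 // ltW // exp3_prob_gt0 // => l.
by rewrite ltW // exp3_weights_gt0.
Qed.

(** The law of [M :: h] is the law of [h] times a conditional probability, so by induction on [n] a
    one-step inequality passes to the expectation. *)
Lemma exp3_submartingale (F : history K -> R) n :
  (forall h, (size h < n)%N ->
     F h <= \sum_M exp3_prob gamma (exp3_weights gamma eta c h) M * F (M :: h)) ->
  F [::] <= \sum_(h : n.-tuple 'I_K) exp3_law gamma eta c h * F h.
Proof.
elim: n => [|n IH] stepF.
  rewrite (bigD1 [tuple]) //= mul1r big1 ?addr0 // => h /eqP; case.
  exact: tuple0.
rewrite (sum_tuple_cons n (fun h => exp3_law gamma eta c h * F h)).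
apply: le_trans (IH _) _ => [h hn|]; first exact/stepF/ltnW.
apply: ler_sum => h _ /=.
apply: le_trans (ler_wpM2l (exp3_law_ge0 h) (stepF h _)) _.
  by rewrite size_tuple.
by rewrite mulr_sumr; apply: ler_sum => M _; rewrite mulrA.
Qed.

End Law.

(** After factoring out [expR (- (q * z))], the bounds [1 + y <= expR y] at [q * z] and [q * z - z],
    averaged with weights [1 - q] and [q], add up to exactly 1. *)
Lemma expR_convex (R : realType) (q z : R) : 0 <= q <= 1 ->
  expR (- (q * z)) <= 1 - q + q * expR (- z).
Proof.
move=> /andP[q0 q1].
have e0 := expR_gt0 (- (q * z)).
have h1 := expR_ge1Dx (q * z).
have h2 := expR_ge1Dx (q * z - z).
have E1 : expR (- (q * z)) * expR (q * z) = 1.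
  by rewrite -expRD addNr expR0.
have E2 : expR (- z) = expR (- (q * z)) * expR (q * z - z).
  by rewrite -expRD; congr expR; ring.
rewrite E2; set E := expR (- (q * z)) in e0 E1 *.
have : E * 1 <= E * ((1 - q) * expR (q * z) + q * expR (q * z - z)).
  apply: ler_wpM2l; first exact: ltW.
  nra.
move=> H; nra.
Qed.

(** * Cost estimates and their soft minimum *)

Section Estimates.
Context (R : realType) (K : nat) (gamma eta : R).
Hypotheses (K_gt0 : (0 < K)%N) (gamma01 : 0 < gamma <= 1) (eta_gt0 : 0 < eta).

(* Exp3 is tracked through its cost estimates x: the weight of arm j is
   exp (- eta * x j), and playing M at cost v adds v / p_M to x M. *)
Definition est_weight (x : 'I_K -> R) (j : 'I_K) : R := expR (- (eta * x j)).

Definition est_prob (x : 'I_K -> R) (j : 'I_K) : R :=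
  exp3_prob gamma (est_weight x) j.

Definition est_step (x : 'I_K -> R) (M : 'I_K) (v : R) (j : 'I_K) : R :=
  if j == M then x j + v / est_prob x M else x j.

(** The soft minimum of the estimates, called Q in the overview; [ln K%:R] makes it 0 at the
    start. *)
Definition est_mix (x : 'I_K -> R) : R :=
  (ln K%:R - ln (\sum_j est_weight x j)) / eta.

Lemma est_weight_gt0 x j : 0 < est_weight x j.
Proof. exact: expR_gt0. Qed.

Lemma est_weight_sum_gt0 x : 0 < \sum_j est_weight x j.
Proof.
rewrite (bigD1 (Ordinal K_gt0)) //= ltr_pwDl ?est_weight_gt0 //.
by rewrite sumr_ge0 // => i _; rewrite ltW // est_weight_gt0.
Qed.

Lemma est_prob_gt0 x j : 0 < est_prob x j.
Proof. by apply: exp3_prob_gt0 => // l; rewrite ltW // est_weight_gt0. Qed.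

Lemma est_prob_sum x : \sum_j est_prob x j = 1.
Proof. by apply: exp3_prob_sum => // l; exact: est_weight_gt0. Qed.

Lemma est_prob_le1 x j : est_prob x j <= 1.
Proof.
rewrite -(est_prob_sum x) (bigD1 j) //= lerDl sumr_ge0 // => i _.
by rewrite ltW // est_prob_gt0.
Qed.

Lemma exp3_update_est x M v :
  exp3_update gamma eta (est_weight x) M v = est_weight (est_step x M v).
Proof.
apply/funext => j; rewrite /exp3_update /est_weight /est_step.
case: eqP => [->|//]; rewrite -expRD /est_prob; congr expR.
by rewrite mulrDr opprD mulrA -!mulNr.
Qed.

Lemma est_weight_step_sum x M v :
  \sum_j est_weight (est_step x M v) j =
  \sum_j est_weight x j
  - est_weight x M * (1 - expR (- (eta * (v / est_prob x M)))).
Proof.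
rewrite (bigD1 M) //= [in RHS](bigD1 M) //=.
rewrite (eq_bigr (est_weight x)); last first.
  by move=> j /negbTE jM; rewrite /est_weight /est_step jM.
rewrite {1}/est_weight /est_step eqxx mulrDr opprD expRD -/(est_weight x M).
ring.
Qed.

(** The total weight is multiplied by [1 - q + q * expR (- (eta * z))], where [q] is the share of
    [M] and [z] the increment of its estimate; convexity bounds the logarithm of this factor below
    by [- (q * (eta * z))]. *)
Lemma est_mix_step x M v :
  est_mix (est_step x M v) <=
  est_mix x + est_weight x M / (\sum_j est_weight x j) * (v / est_prob x M).
Proof.
have W0 := est_weight_sum_gt0 x.
set W := \sum_j est_weight x j in W0 *.
set z := v / est_prob x M; set q := est_weight x M / W.
have q01 : 0 <= q <= 1.
  rewrite divr_ge0 ?(ltW W0) ?(ltW (est_weight_gt0 x M)) //=.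
  rewrite ler_pdivrMr // mul1r /W.
  rewrite (bigD1 M) //= lerDl sumr_ge0 // => i _.
  by rewrite ltW // est_weight_gt0.
have H := expR_convex (eta * z) q01.
have WE : \sum_j est_weight (est_step x M v) j =
    W * (1 - q + q * expR (- (eta * z))).
  rewrite est_weight_step_sum -/W -/z /q; field.
  by rewrite gt_eqF.
have f0 : 0 < 1 - q + q * expR (- (eta * z)) by exact: lt_le_trans (expR_gt0 _) H.
rewrite /est_mix WE lnM ?posrE // -/W.
have : - (q * (eta * z)) <= ln (1 - q + q * expR (- (eta * z))).
  by rewrite -[leLHS]expRK ler_ln ?posrE ?expR_gt0.
move=> Hln; rewrite ler_pdivrMr // mulrDl divfK ?gt_eqF //; nra.
Qed.

(** On average the factors [1 / p] cancel, leaving the costs weighted by the shares [q]. As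
    [(1 - gamma) * q M <= p M], replacing [q] by [p] loses at most [gamma]. *)
Lemma est_mix_supermartingale x (v : 'I_K -> R) :
  (forall j, 0 <= v j <= 1) ->
  \sum_M est_prob x M * est_mix (est_step x M (v M)) <=
  est_mix x + \sum_M est_prob x M * v M + gamma.
Proof.
move=> v01; have W0 := est_weight_sum_gt0 x.
have [g0 g1] := andP gamma01.
pose q M := est_weight x M / (\sum_j est_weight x j).
have q0 M : 0 <= q M by rewrite divr_ge0 ?ltW ?est_weight_gt0.
have sq : \sum_M q M = 1 by rewrite -mulr_suml divff ?gt_eqF.
have -> : est_mix x = \sum_M est_prob x M * est_mix x.
  by rewrite -mulr_suml est_prob_sum mul1r.
have -> : gamma = \sum_M gamma * q M by rewrite -mulr_sumr sq mulr1.
rewrite -!big_split /=; apply: ler_sum => M _.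
have p0 := est_prob_gt0 x M.
apply: le_trans (ler_wpM2l (ltW p0) (est_mix_step x M (v M))) _.
rewrite -/(q M) mulrDr -addrA lerD2l.
have -> : est_prob x M * (q M * (v M / est_prob x M)) = q M * v M.
  by field; rewrite gt_eqF.
have : (1 - gamma) * q M <= est_prob x M.
  rewrite /est_prob /exp3_prob -mulrA -/(q M) lerDl divr_ge0 //; exact: ltW.
have /andP[v0 v1] := v01 M; move=> Hp.
have H1 : 0 <= v M * (est_prob x M - (1 - gamma) * q M) by rewrite mulr_ge0 ?subr_ge0.
have H2 : 0 <= gamma * q M * (1 - v M) by apply: mulr_ge0; rewrite ?subr_ge0 // mulr_ge0 // ltW.
nra.
Qed.

End Estimates.

(** * From a potential to a cost schedule *)

Section Adversary.
Context (R : realType) (K : nat) (gamma eta : R) (i0 i1 : 'I_K).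
Hypotheses (K_gt0 : (0 < K)%N) (gamma01 : 0 < gamma <= 1) (eta_gt0 : 0 < eta).

(* Cost estimates of all arms, and true cumulative costs of i0 and i1. *)
Definition play_state : Type := ('I_K -> R) * R * R.

Definition play_start : play_state := (fun=> 0, 0, 0).

Definition play_next (s : play_state) (v : 'I_K -> R) (M : 'I_K) : play_state :=
  (est_step gamma eta s.1.1 M (v M), s.1.2 + v i0, s.2 + v i1).

Section Policy.
(* pi n s is the cost vector chosen when n rounds remain. *)
Context (T : nat) (pi : nat -> play_state -> 'I_K -> R).

Fixpoint play_run (h : history K) : play_state :=
  if h is M :: h' then
    play_next (play_run h') (pi (T - size h') (play_run h')) M
  else play_start.

Definition policy_schedule : schedule R K :=
  fun h => pi (T - size h) (play_run h).

Lemma exp3_weights_run h :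
  exp3_weights gamma eta policy_schedule h = est_weight eta (play_run h).1.1.
Proof.
elim: h => [|M h IH] /=.
  by apply/funext => j; rewrite /est_weight mulr0 oppr0 expR0.
by rewrite IH exp3_update_est.
Qed.

Lemma arm_cost_run h :
  (arm_cost policy_schedule i0 h = (play_run h).1.2) *
  (arm_cost policy_schedule i1 h = (play_run h).2).
Proof. by elim: h => [|M h IH] /=; split; rewrite ?IH. Qed.

End Policy.

Lemma arm_cost_ge0 (c : schedule R K) j h : cost_schedule c -> 0 <= arm_cost c j h.
Proof.
move=> c01; elim: h => [|M h IH] //=; rewrite addr_ge0 //.
by case/andP: (c01 h j).
Qed.

Lemma regret_ge (c : schedule R K) j h : cost_schedule c ->
  gambler_cost c h - arm_cost c j h <= regret c h.
Proof.
move=> c01; rewrite lerD2l lerN2; apply: ge_inf; last by exists j.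
by exists 0 => _ [l _ <-]; exact: arm_cost_ge0.
Qed.

(** [Phi n s] is a value that the adversary can guarantee, with [n] rounds left, for Q minus the
    true cost of the cheaper of [i0] and [i1]. These two arms suffice, since the regret is at least
    that against any single arm. *)
Lemma adversary_value (Phi : nat -> play_state -> R) (T : nat) :
  (forall n s, exists v : 'I_K -> R, (forall j, 0 <= v j <= 1) /\
     Phi n.+1 s <=
       \sum_M est_prob gamma eta s.1.1 M * Phi n (play_next s v M)) ->
  (forall s, Phi 0 s <= est_mix eta s.1.1 - Num.min s.1.2 s.2) ->
  exists c : schedule R K, cost_schedule c /\
    Phi T play_start - gamma * T%:R <= exp3_expected_regret gamma eta c T.
Proof.
move=> stepPhi endPhi.
have [pi piP] := choice (fun ns : nat * play_state => stepPhi ns.1 ns.2).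
(* A policy is indexed by the rounds left including the current one, which is [n.+1] in
   [stepPhi]. *)
pose pol n s := pi (n.-1, s).
pose c := policy_schedule T pol.
have c01 : cost_schedule c.
  move=> h j; exact: (piP ((T - size h).-1, play_run T pol h)).1.
exists c; split=> //.
have [g0 g1] := andP gamma01.
(* The gambler's cost minus Q plus [gamma] per elapsed round is a submartingale, and so is [Phi]
   along the play; after [T] rounds their sum, less [gamma * T%:R], is at most the regret. *)
pose F h := gambler_cost c h - est_mix eta (play_run T pol h).1.1
  + gamma * (size h)%:R - gamma * T%:R + Phi (T - size h)%N (play_run T pol h).
have F0 : F [::] = Phi T play_start - gamma * T%:R.
  rewrite /F /= subn0 mulr0 addr0 /est_mix /=.
  rewrite (eq_bigr (fun=> 1)); last first.
    by move=> j _; rewrite /est_weight mulr0 oppr0 expR0.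
  by rewrite sumr_const card_ord subrr mul0r subrr sub0r addrC.
rewrite -F0; apply: le_trans (exp3_submartingale (eta := eta) (c := c) (n := T) K_gt0 gamma01 _) _.
  move=> h hT; rewrite exp3_weights_run -/(est_prob _ _ _).
  set s := play_run T pol h.
  have := est_mix_supermartingale K_gt0 gamma01 eta_gt0 s.1.1 (c01 h).
  have := (piP ((T - size h).-1, s)).2 => /=.
  have -> : ((T - size h).-1.+1 = T - size h)%N by rewrite prednK // subn_gt0.
  have sumP z : z = \sum_M est_prob gamma eta s.1.1 M * z.
    by rewrite -mulr_suml est_prob_sum // mul1r.
  move=> HPhi HQ.
  have -> : \sum_M est_prob gamma eta s.1.1 M * F (M :: h) =
    gambler_cost c h + gamma * (size h).+1%:R - gamma * T%:R
    + \sum_M est_prob gamma eta s.1.1 M * c h M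
    - \sum_M est_prob gamma eta s.1.1 M * est_mix eta (est_step gamma eta s.1.1 M (c h M))
    + \sum_M est_prob gamma eta s.1.1 M * Phi (T - size h).-1 (play_next s (c h) M).
    rewrite [X in X + _ - _ + _]sumP -sumrN -!big_split /=; apply: eq_bigr => M _.
    rewrite /F /= -/s subnS -/(c h) /c /policy_schedule -/s; ring.
  rewrite /F -/s -natr1.
  move: HPhi HQ; rewrite /c /policy_schedule -/s /pol; lra.
apply: ler_sum => h _; apply: ler_wpM2l; first exact: exp3_law_ge0.
have := endPhi (play_run T pol h).
have H0 := regret_ge i0 h c01.
have H1 := regret_ge i1 h c01.
rewrite /F size_tuple subnn addrK.
rewrite !arm_cost_run in H0 H1.
by rewrite /Num.min; case: ifP => _ ?; lra.
Qed.

End Adversary.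

(** * Constant costs: much exploration or slow learning *)

Section ConstantCosts.
Context (R : realType) (K : nat) (gamma eta : R) (i0 i1 : 'I_K).
Hypotheses (K_gt0 : (0 < K)%N) (gamma01 : 0 < gamma <= 1) (eta_gt0 : 0 < eta).
Hypothesis (i01 : i0 != i1).

Definition one_bad_arm : schedule R K := fun _ j => (j == i1)%:R.

Lemma one_bad_arm_cost : cost_schedule one_bad_arm.
Proof. by move=> h j; rewrite /one_bad_arm; case: eqP; rewrite ?lexx ?ler01. Qed.

Lemma exp3_weights_le1 (c : schedule R K) h j : cost_schedule c ->
  exp3_weights gamma eta c h j <= 1.
Proof.
move=> c01; elim: h j => [|M h IH] j //=.
rewrite /exp3_update; case: ifP => _ //.
rewrite -[leRHS]mul1r; apply: ler_pM; rewrite ?expR_ge0 ?IH //.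
  by rewrite ltW // exp3_weights_gt0.
have w0 l : 0 <= exp3_weights gamma eta c h l by rewrite ltW // exp3_weights_gt0.
rewrite -[leRHS]expR0 ler_expR !mulNr oppr_le0 !mulr_ge0 ?invr_ge0 //.
- exact: ltW.
- by case/andP: (c01 h M).
- by rewrite ltW // exp3_prob_gt0.
Qed.

(** [i0] costs nothing, so the regret is at least the gambler's cost, which grows by [p i1] per
    round on average; [G] bounds from below the expected cost still to come. *)
Lemma one_bad_arm_regret (T : nat) (G : history K -> R) :
  (forall h, (size h < T)%N ->
    forall p, p = exp3_prob gamma (exp3_weights gamma eta one_bad_arm h) ->
    G h <= p i1 + \sum_M p M * G (M :: h)) ->
  (forall h, size h = T -> G h <= 0) ->
  G [::] <= exp3_expected_regret gamma eta one_bad_arm T.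
Proof.
move=> stepG endG; pose F h := gambler_cost one_bad_arm h + G h.
have -> : G [::] = F [::] by rewrite /F add0r.
apply: le_trans (exp3_submartingale (eta := eta) (c := one_bad_arm) (n := T) K_gt0 gamma01 _) _.
  move=> h hT; have := stepG h hT _ erefl => /=.
  set p := exp3_prob _ _; move=> HG.
  have sp : \sum_M p M = 1.
    by apply: exp3_prob_sum => // l; exact: exp3_weights_gt0.
  have -> : \sum_M p M * F (M :: h) =
      gambler_cost one_bad_arm h + p i1 + \sum_M p M * G (M :: h).
    rewrite -[X in X + p i1]mul1r -sp mulr_suml.
    have -> : p i1 = \sum_M p M * (M == i1)%:R.
      rewrite (bigD1 i1) //= eqxx mulr1 big1 ?addr0 // => j /negbTE->.
      by rewrite mulr0.
    by rewrite -!big_split /=; apply: eq_bigr => M _; rewrite -!mulrDr.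
  by rewrite /F -addrA lerD2l.
apply: ler_sum => h _; apply: ler_wpM2l; first exact: exp3_law_ge0.
have H0 := regret_ge i0 h one_bad_arm_cost.
have a0 : arm_cost one_bad_arm i0 h = 0.
  elim: (tval h) => [//|M h' IH] /=.
  by rewrite IH /one_bad_arm (negbTE i01) addr0.
rewrite a0 subr0 in H0; apply: le_trans H0.
by rewrite /F gerDl endG // size_tuple.
Qed.

Lemma one_bad_arm_exploration (T : nat) :
  gamma / K%:R * T%:R <= exp3_expected_regret gamma eta one_bad_arm T.
Proof.
pose G (h : history K) := gamma / K%:R * (T%:R - (size h)%:R).
have -> : gamma / K%:R * T%:R = G [::] by rewrite /G /= subr0.
apply: one_bad_arm_regret => h hT; last by rewrite /G hT subrr mulr0.
move=> p pE; have sp : \sum_M p M = 1.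
  by rewrite pE; apply: exp3_prob_sum => // l; exact: exp3_weights_gt0.
rewrite /G /= -mulr_suml sp.
have : gamma / K%:R <= p i1.
  by rewrite pE; apply: exp3_prob_ge => // l; rewrite ltW // exp3_weights_gt0.
by rewrite -natr1; nra.
Qed.

(* The logarithm of the weight of the bad arm drifts by exactly - eta, so the
   arm keeps a substantial weight for about 1 / eta rounds. *)
Lemma one_bad_arm_slow_learning (T N : nat) : (N <= T)%N ->
  (N%:R - eta * N%:R ^+ 2) / K%:R <= exp3_expected_regret gamma eta one_bad_arm T.
Proof.
move=> NT; have k0 : 0 < K%:R :> R by rewrite ltr0n.
pose lw h : R := ln (exp3_weights gamma eta one_bad_arm h i1).
(* In each of the [n] rounds left of the first [N], [i1] has probability at least [(1 + lw) / K%:R],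
   where [lw] falls by [eta] per round on average. Truncated subtraction makes [G] vanish
   afterwards. *)
pose G (h : history K) : R :=
  let n := (N - size h)%N%:R in (n * (1 + lw h) - eta * n ^+ 2) / K%:R.
have -> : (N%:R - eta * N%:R ^+ 2) / K%:R = G [::].
  by rewrite /G /lw /= subn0 ln1 addr0 mulr1.
apply: one_bad_arm_regret => h hT; last first.
  by rewrite /G hT (eqP (_ : N - T == 0)%N) ?subn_eq0 // mul0r expr0n /= mulr0 subrr mul0r.
move=> p pE.
have w0 l : 0 < exp3_weights gamma eta one_bad_arm h l by exact: exp3_weights_gt0.
have p0 j : 0 < p j by rewrite pE; apply: exp3_prob_gt0 => // l; exact: ltW.
have [Nh|hN] := leqP N (size h).
  rewrite big1 ?addr0 => [|M _]; rewrite /G /=.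
    by rewrite (eqP (_ : N - size h == 0)%N) ?subn_eq0 // mul0r expr0n /= mulr0 subrr mul0r ltW.
  rewrite (eqP (_ : N - (size h).+1 == 0)%N) ?subn_eq0 ?leqW //.
  by rewrite mul0r expr0n /= mulr0 subrr mul0r mulr0.
have step M : lw (M :: h) = lw h - (M == i1)%:R * (eta / p i1).
  rewrite /lw /= /exp3_update eq_sym; case: eqP => [->|_]; last by rewrite mul0r subr0.
  rewrite lnM ?posrE ?expR_gt0 // expRK /one_bad_arm eqxx mulr1.
  by rewrite mul1r -pE mulNr.
have sp : \sum_M p M = 1 by rewrite pE; exact: exp3_prob_sum.
set n := (N - (size h).+1)%N%:R : R.
have En : (N - size h)%N%:R = n + 1 :> R.
  by rewrite /n natr1 -subSn.
have -> : \sum_M p M * G (M :: h) =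
    (n * (1 + lw h - eta) - eta * n ^+ 2) / K%:R.
  transitivity (\sum_M (p M * ((n * (1 + lw h) - eta * n ^+ 2) / K%:R)
     - (M == i1)%:R * p M * (n * (eta / p i1) / K%:R))).
    apply: eq_bigr => M _; rewrite /G /= step -/n.
    by clear En; move: n (_ == _)%:R => m d; ring.
  rewrite big_split /= -mulr_suml sp sumrN (bigD1 i1) //= eqxx big1 => [|j /negbTE->].
    clear En; move: n => m; rewrite mulr1n; field.
    by rewrite !gt_eqF.
  by rewrite !mul0r.
have pw : (1 + lw h) / K%:R <= p i1.
  have w1 := exp3_weights_le1 h i1 one_bad_arm_cost.
  have lnw : 1 + lw h <= exp3_weights gamma eta one_bad_arm h i1.
    have := expR_ge1Dx (lw h); rewrite lnK //; exact: w0.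
  have W0 : 0 < \sum_l exp3_weights gamma eta one_bad_arm h l.
    rewrite (bigD1 i1) //= ltr_pwDl // sumr_ge0 // => i _; exact: ltW.
  have WK : \sum_l exp3_weights gamma eta one_bad_arm h l <= K%:R.
    apply: le_trans (_ : \sum_(l < K) 1 <= _).
      by apply: ler_sum => l _; apply: exp3_weights_le1; exact: one_bad_arm_cost.
    by rewrite sumr_const card_ord.
  rewrite pE /exp3_prob ler_pdivrMr // mulrDl divfK ?gt_eqF //.
  move: w1 lnw; set w := exp3_weights _ _ _ _ _; set W := \sum_l _ in W0 WK *.
  move=> w1 lnw; have w00 : 0 < w by exact: w0.
  have [g0 g1] := andP gamma01.
  have : (1 - gamma) * w <= (1 - gamma) * w / W * K%:R.
    rewrite -mulrA ler_peMr ?mulr_ge0 ?subr_ge0 ?(ltW w00) //.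
    by rewrite mulrC ler_pdivlMr // mul1r.
  nra.
apply: le_trans (lerD pw (lexx _)).
rewrite /G En -mulrDl ler_pM2r ?invr_gt0 //.
have := mulr_ge0 (ltW eta_gt0) (ler0n R (N - (size h).+1)).
clear En; rewrite -/n; move: n => m; have := eta_gt0; lra.
Qed.

End ConstantCosts.

(** * Punishment: the other estimates catch up with that of [i1] *)

Section Punish.
Context (R : realType) (K : nat) (gamma eta : R) (i0 i1 : 'I_K).
Hypotheses (K_gt0 : (0 < K)%N) (gamma01 : 0 < gamma <= 1) (eta_gt0 : 0 < eta).

Lemma est_step0 x M : est_step gamma eta x M 0 = x :> ('I_K -> R).
Proof. by apply/funext => j; rewrite /est_step mul0r addr0 if_same. Qed.

Definition idle_value (s : play_state R K) : R :=
  est_mix eta s.1.1 - Num.min s.1.2 s.2.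

Lemma idle_value_step s M :
  idle_value (play_next gamma eta i0 i1 s (fun=> 0) M) = idle_value s.
Proof. by rewrite /idle_value /= est_step0 !addr0. Qed.

(** Measures how far the other estimates lag behind that of [i1]. The exponent is not scaled by
    [eta], which keeps the bounds below free of [eta]. *)
Definition gap_sum (x : 'I_K -> R) : R := \sum_j expR (x i1 - x j).

Definition punish_cost (j : 'I_K) : R := (j != i1)%:R.

(** A play of [M] at cost 1 raises its estimate by [1 / p >= 1], which at least halves its term. *)
Lemma gap_sum_step x M :
  gap_sum (est_step gamma eta x M (punish_cost M)) <=
  gap_sum x - (M != i1)%:R * (expR (x i1 - x M) / 2).
Proof.
rewrite /punish_cost; case: eqP => [->|/eqP Mi] /=.
  by rewrite est_step0 mul0r subr0.
have p0 := est_prob_gt0 eta K_gt0 gamma01 x M.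
have p1 := est_prob_le1 eta K_gt0 gamma01 x M.
rewrite mul1r /gap_sum (bigD1 M) //= [in leRHS](bigD1 M) //=.
have -> : \sum_(i < K | i != M) expR (est_step gamma eta x M 1 i1 - est_step gamma eta x M 1 i) =
    \sum_(i < K | i != M) expR (x i1 - x i).
  apply: eq_bigr => j /negbTE jM.
  by rewrite /est_step jM eq_sym (negbTE Mi).
rewrite {1 2}/est_step eqxx [i1 == M]eq_sym (negbTE Mi) addrAC lerD2r.
set z := 1 / _; have z1 : 1 <= z by rewrite /z ler_pdivlMr ?mul1r.
have -> : x i1 - (x M + z) = (x i1 - x M) + - z by ring.
have g0 := expR_gt0 (x i1 - x M).
have : expR (- z) <= 1 / 2.
  have : expR (- z) * expR z = 1 by rewrite -expRD addNr expR0.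
  have := expR_ge1Dx z; have := expR_gt0 (- z); nra.
rewrite expRD; nra.
Qed.

Lemma max_weight_prob (x : 'I_K -> R) m : (forall j, x m <= x j) ->
  K%:R^-1 <= est_prob gamma eta x m.
Proof.
move=> xm; have k0 : 0 < K%:R :> R by rewrite ltr0n.
have W0 := est_weight_sum_gt0 eta K_gt0 x.
have [g0 g1] := andP gamma01.
have WK : \sum_j est_weight eta x j <= K%:R * est_weight eta x m.
  apply: le_trans (_ : \sum_(j < K) est_weight eta x m <= _).
    apply: ler_sum => j _; rewrite ler_expR lerN2 ler_pM2l //.
  by rewrite sumr_const card_ord mulr_natl.
have : K%:R^-1 <= est_weight eta x m / \sum_j est_weight eta x j.
  by rewrite ler_pdivlMr // mulrC ler_pdivrMr // mulrC.
rewrite /est_prob /exp3_prob; move: (K%:R^-1) => ki H; nra.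
Qed.

(** The arm [m] of smallest estimate is played with probability at least [1 / K] and carries at
    least a fraction [1 / K] of the sum. *)
Lemma gap_sum_contraction (x : 'I_K -> R) :
  \sum_M est_prob gamma eta x M * gap_sum (est_step gamma eta x M (punish_cost M))
  <= (1 - (2 * K%:R ^+ 2)^-1) * gap_sum x + 1.
Proof.
have k1 : 1 <= K%:R :> R by rewrite ler1n.
pose m := [arg min_(j < i1) x j]%O.
have xm j : x m <= x j by rewrite /m; case: arg_minP => // i _; exact.
have pm := max_weight_prob xm.
have Zm : gap_sum x <= K%:R * expR (x i1 - x m).
  apply: le_trans (_ : \sum_(j < K) expR (x i1 - x m) <= _).
    by apply: ler_sum => j _; rewrite ler_expR lerD2l lerN2.
  by rewrite sumr_const card_ord mulr_natl.
have p0 j := est_prob_gt0 eta K_gt0 gamma01 x j.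
apply: le_trans (_ : gap_sum x - est_prob gamma eta x m * ((m != i1)%:R * (expR (x i1 - x m) / 2)) <= _).
  apply: le_trans (ler_sum _ (fun M _ => ler_wpM2l (ltW (p0 M)) (gap_sum_step x M))) _.
  under eq_bigr do rewrite mulrBr.
  rewrite sumrB -mulr_suml est_prob_sum // mul1r lerD2l lerN2.
  rewrite [leRHS](bigD1 m) //= lerDl sumr_ge0 // => j _.
  by rewrite !mulr_ge0 ?ler0n ?expR_ge0 // ltW.
have Z0 : 0 <= gap_sum x by apply: sumr_ge0 => j _; exact: expR_ge0.
have kE : (2 * K%:R ^+ 2)^-1 * gap_sum x <= K%:R^-1 * (expR (x i1 - x m) / 2).
  rewrite mulrC ler_pdivrMr ?mulr_gt0 ?exprn_gt0 ?(lt_le_trans ltr01 k1) //.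
  suff -> : K%:R^-1 * (expR (x i1 - x m) / 2) * (2 * K%:R ^+ 2) = K%:R * expR (x i1 - x m) by [].
  by field; rewrite gt_eqF // (lt_le_trans ltr01 k1).
have ki1 : K%:R^-1 <= 1 :> R by rewrite invf_le1 // (lt_le_trans ltr01 k1).
have ki0 : 0 <= K%:R^-1 :> R by rewrite invr_ge0 (le_trans ler01 k1).
have E0 := expR_gt0 (x i1 - x m).
(* If [m] is [i1], its play is free and brings no decrease, but then all terms are at most 1 and the
   [+ 1] covers the deficit. *)
case: eqP => [mi|_] /=.
  move: kE; rewrite mi subrr expR0; nra.
rewrite mulr1n mul1r; nra.
Qed.

(* The fixed point of the recursion in gap_sum_contraction. *)
Definition gap_bound : R := 2 * K%:R ^+ 2.

(** [i1] is free during punishment, so its estimated and true costs stay fixed; the subtracted term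
    bounds the expected final gap sum by iterating the contraction [n] times. *)
Definition punish_value n (s : play_state R K) : R :=
  s.1.1 i1 - s.2
  - ((1 - gap_bound^-1) ^+ n * (gap_sum s.1.1 - gap_bound) + gap_bound).

Lemma gap_bound_ge1 : 1 <= gap_bound.
Proof.
have k1 : 1 <= K%:R :> R by rewrite ler1n.
by rewrite /gap_bound expr2; nra.
Qed.

Lemma punish_value_step n s :
  punish_value n.+1 s <=
  \sum_M est_prob gamma eta s.1.1 M *
    punish_value n (play_next gamma eta i0 i1 s punish_cost M).
Proof.
have B1 := gap_bound_ge1.
have rn : 0 <= (1 - gap_bound^-1) ^+ n :> R.
  apply: exprn_ge0; rewrite subr_ge0 invf_le1 //; exact: lt_le_trans ltr01 B1.
have BV : gap_bound^-1 * gap_bound = 1.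
  by rewrite mulVf // gt_eqF // (lt_le_trans ltr01 B1).
have H := gap_sum_contraction s.1.1.
set S := \sum_M _ in H.
have -> : \sum_M est_prob gamma eta s.1.1 M *
    punish_value n (play_next gamma eta i0 i1 s punish_cost M) =
  s.1.1 i1 - s.2 - ((1 - gap_bound^-1) ^+ n * (S - gap_bound) + gap_bound).
  transitivity (\sum_M (est_prob gamma eta s.1.1 M *
     (s.1.1 i1 - s.2 + (1 - gap_bound^-1) ^+ n * gap_bound - gap_bound)
     - (1 - gap_bound^-1) ^+ n * (est_prob gamma eta s.1.1 M *
       gap_sum (est_step gamma eta s.1.1 M (punish_cost M))))).
    apply: eq_bigr => M _; rewrite /punish_value /=.
    have -> : est_step gamma eta s.1.1 M (punish_cost M) i1 = s.1.1 i1.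
      rewrite /est_step; have [<-|//] := eqVneq i1 M.
      by rewrite /punish_cost eqxx mul0r addr0.
    rewrite [punish_cost i1]/punish_cost eqxx addr0.
    by ring.
  rewrite sumrB -mulr_suml est_prob_sum // -mulr_sumr -/S mul1r.
  by ring.
rewrite /punish_value exprSr lerD2l lerN2 lerD2r -mulrA ler_wpM2l //.
rewrite /gap_bound in H BV *; lra.
Qed.

(** Since [y <= expR y], every estimate is at least that of [i1] minus the gap sum, and so is their
    soft minimum. *)
Lemma punish_value_end s : punish_value 0 s <= idle_value s.
Proof.
rewrite /punish_value /idle_value expr0 mul1r subrK.
have k0 : 0 < K%:R :> R by rewrite ltr0n.
have W0 := est_weight_sum_gt0 eta K_gt0 s.1.1.
have xZ j : s.1.1 i1 - gap_sum s.1.1 <= s.1.1 j.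
  have : expR (s.1.1 i1 - s.1.1 j) <= gap_sum s.1.1.
    rewrite /gap_sum (bigD1 j) //= lerDl sumr_ge0 // => l _; exact: expR_ge0.
  have := expR_ge1Dx (s.1.1 i1 - s.1.1 j); lra.
have : s.1.1 i1 - gap_sum s.1.1 <= est_mix eta s.1.1.
  rewrite /est_mix ler_pdivlMr //.
  suff : ln (\sum_j est_weight eta s.1.1 j) <=
      ln K%:R - eta * (s.1.1 i1 - gap_sum s.1.1) by lra.
  have -> : ln K%:R - eta * (s.1.1 i1 - gap_sum s.1.1) =
      ln (K%:R * expR (- (eta * (s.1.1 i1 - gap_sum s.1.1)))).
    by rewrite lnM ?posrE ?expR_gt0 // expRK.
  rewrite ler_ln ?posrE ?mulr_gt0 ?expR_gt0 //.
  set z := expR _; have -> : K%:R * z = \sum_(j < K) z.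
    by rewrite sumr_const card_ord mulr_natl.
  apply: ler_sum => j _.
  by rewrite ler_expR lerN2 ler_pM2l.
have : Num.min s.1.2 s.2 <= s.2 by rewrite ge_min lexx orbT.
lra.
Qed.

End Punish.

(** * The exploration potential as a function of real variables *)

Section ExplorePotential.
Context (R : realType) (A r L eta : R).

(* Here z - b is the excess of the estimated over the true cost of the explored
   arm, a martingale; r is a lower bound on its quadratic variation per round
   once the arm is rarely played, and the term in L pays for the rounds before. *)
Definition explore_potential (t z b : R) : R :=
  (z - b) + ((z - b) ^+ 2 - r * t + 3 * A * r * Num.min (eta * z) L) / (4 * A)
  + A / 2.

Hypotheses (A_ge1 : 1 <= A) (r_ge0 : 0 <= r) (rL_le : 12 * r * L <= A).

Let A_gt0 : 0 < A := lt_le_trans ltr01 A_ge1.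

(** [z - b] moves by [- p * d] or [(1 - p) * d]: its mean is unchanged and that of its square grows
    by [p * (1 - p) * d ^+ 2]. The hypothesis is the whole mean increment times [4 * A]. *)
Lemma explore_potential_step t z b p d :
  0 <= p * (1 - p) * d ^+ 2 - r
    + 3 * A * r * p * (Num.min (eta * (z + d)) L - Num.min (eta * z) L) ->
  explore_potential t z b <=
    (1 - p) * explore_potential (t + 1) z (b + p * d)
    + p * explore_potential (t + 1) (z + d) (b + p * d).
Proof.
rewrite /explore_potential => H; rewrite -subr_ge0.
set m' := Num.min (eta * (z + d)) _ in H *; set m := Num.min (eta * z) _ in H *.
apply: le_trans (_ : (p * (1 - p) * d ^+ 2 - r + 3 * A * r * p * (m' - m)) / (4 * A) <= _).
  by rewrite divr_ge0 // mulr_ge0 // ltW.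
rewrite le_eqVlt; apply/orP; left; apply/eqP; field.
by rewrite gt_eqF.
Qed.

Lemma explore_potential_le t z b :
  explore_potential t z b <=
    (z - b) + (z - b) ^+ 2 / (4 * A) - r * t / (4 * A) + A / 16 + A / 2.
Proof.
rewrite /explore_potential.
set m := Num.min _ _; have mL : m <= L by rewrite ge_min lexx orbT.
have E : 3 * A * r * m / (4 * A) = r * m * (3 / 4) by field; rewrite gt_eqF.
have : r * m <= r * L by exact: ler_wpM2l.
rewrite 2![(_ + _) / (4 * A)]mulrDl mulNr E.
have := rL_le; rewrite -mulrA.
move: (z - b) (r * L) (r * m) ((z - b) ^+ 2 / _) (r * t / _) => *; lra.
Qed.

Let A4_gt0 : 0 < 4 * A.
Proof. exact: mulr_gt0. Qed.

(** A downward exit overshoots [- A] by at most 1, the largest cost of a round. *)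
Lemma explore_potential_down t z b : 0 <= t -> - A - 1 <= z - b <= - A ->
  explore_potential t z b <= 0.
Proof.
have A1 := A_ge1; have A0 := A_gt0; move=> t0 /andP[y1 y2].
apply: le_trans (explore_potential_le _ _ _) _.
have : 0 <= r * t / (4 * A) by apply: divr_ge0; [exact: mulr_ge0 | exact: ltW].
move: (z - b) y1 y2 => y y1 y2.
(* This says that [y] lies between the roots [- 3 * A] and [- A] of a quadratic. *)
have : y ^+ 2 / (4 * A) <= - y - 3 / 4 * A.
  rewrite ler_pdivrMr //.
  have : (y + A) * (y + 3 * A) <= 0 by rewrite mulr_le0_ge0 //; lra.
  by lra.
move: (r * t / _) (y ^+ 2 / _) => *; lra.
Qed.

Lemma explore_potential_timeout t z b :
  16 * A ^+ 2 <= r * t -> - A <= z - b <= A -> explore_potential t z b <= 0.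
Proof.
have A0 := A_gt0; move=> rt /andP[y1 y2].
apply: le_trans (explore_potential_le _ _ _) _.
have : 4 * A <= r * t / (4 * A).
  rewrite ler_pdivlMr //; apply: le_trans rt; rewrite expr2; lra.
move: (z - b) y1 y2 => y y1 y2.
have : y ^+ 2 / (4 * A) <= A / 4.
  rewrite ler_pdivrMr //.
  have : 0 <= (A - y) * (A + y) by rewrite mulr_ge0 //; lra.
  lra.
move: (r * t / _) (y ^+ 2 / _) => *; lra.
Qed.

(** An upward exit is a jump of at most [6 * k * A] from below [A], whence the range up to
    [7 * k * A]. *)
Lemma explore_potential_up k t z b : 2 <= k -> 0 <= t ->
  0 <= z - b <= 7 * k * A -> explore_potential t z b <= 16 * k ^+ 2 * A.
Proof.
have A0 := A_gt0; move=> k2 t0 /andP[y1 y2].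
apply: le_trans (explore_potential_le _ _ _) _.
have : 0 <= r * t / (4 * A) by apply: divr_ge0; [exact: mulr_ge0 | exact: ltW].
move: (z - b) y1 y2 => y y1 y2.
have : y ^+ 2 / (4 * A) <= 49 / 4 * k ^+ 2 * A.
  rewrite ler_pdivrMr //.
  have : 0 <= (7 * k * A - y) * (7 * k * A + y).
    rewrite mulr_ge0 ?subr_ge0 // addr_ge0 // !mulr_ge0 //; lra.
  lra.
have : 0 <= (k - 2) * A by rewrite mulr_ge0 //; lra.
have : 0 <= (k - 2) * k * A by rewrite !mulr_ge0 //; lra.
move: (r * t / _) (y ^+ 2 / _) => p q H1 H2 H3 H4; lra.
Qed.

End ExplorePotential.

(** * Exploration and the combined strategy *)

Section Explore.
Context (R : realType) (K : nat) (gamma eta : R) (i0 i1 : 'I_K).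
Hypotheses (K_ge2 : (2 <= K)%N) (gamma01 : 0 < gamma <= 1) (eta_gt0 : 0 < eta).
Hypothesis (i01 : i0 != i1).

Let K_gt0 : (0 < K)%N := ltnW K_ge2.

Let k_ge2 : 2 <= K%:R :> R.
Proof. by rewrite ler_nat. Qed.

(** The estimates as long as only [i1] has been charged. *)
Definition solo (z : R) : 'I_K -> R := fun j => if j == i1 then z else 0.

Definition solo_prob (z : R) : R :=
  (1 - gamma) * expR (- (eta * z)) / (K%:R - 1 + expR (- (eta * z)))
  + gamma / K%:R.

Lemma est_prob_solo z : est_prob gamma eta (solo z) i1 = solo_prob z.
Proof.
rewrite /est_prob /exp3_prob /solo_prob {1}/est_weight {1}/solo eqxx.
congr (_ / _ + _).
rewrite (bigD1 i1) //= {1}/est_weight {1}/solo eqxx addrC; congr (_ + _).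
rewrite (eq_bigr (fun=> 1)) => [|j /negbTE ji]; last first.
  by rewrite /est_weight /solo ji mulr0 oppr0 expR0.
rewrite sumr_const cardC1 card_ord -subn1 natrB //.
Qed.

Lemma solo_prob_bounds z : [/\ 0 < solo_prob z, solo_prob z <= 1 & gamma / K%:R <= solo_prob z].
Proof.
rewrite -est_prob_solo; split; first exact: est_prob_gt0.
  exact: est_prob_le1.
by apply: exp3_prob_ge => // j; exact: expR_ge0.
Qed.

Lemma solo_prob_le z : solo_prob z <= expR (- (eta * z)) + gamma.
Proof.
have [g0 g1] := andP gamma01; have k2 := k_ge2.
rewrite /solo_prob; have w0 := expR_gt0 (- (eta * z)).
set w := expR _ in w0 *; apply: lerD.
  rewrite ler_pdivrMr; last by lra.
  nra.
rewrite ler_pdivrMr; last by lra.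
nra.
Qed.

(** The weight of [i1] shrinks by a factor [expR (- (eta * d)) >= 1 / 4], and the total weight does
    not grow. *)
Lemma solo_prob_drop z d : 0 <= d -> eta * d <= 1 ->
  solo_prob z <= 4 * solo_prob (z + d).
Proof.
move=> d0 ed1; have [g0 g1] := andP gamma01; have k2 := k_ge2.
rewrite /solo_prob [eta * (z + d)]mulrDr opprD expRD.
have w0 := expR_gt0 (- (eta * z)).
have e1 : expR (- (eta * d)) <= 1.
  by rewrite -[leRHS]expR0 ler_expR oppr_le0 mulr_ge0 // ltW.
have e4 : 1 / 4 <= expR (- (eta * d)).
  have : expR (- (eta * d)) = expR (- (eta * d) / 2) * expR (- (eta * d) / 2).
    by rewrite -expRD; congr expR; field.
  have := expR_ge1Dx (- (eta * d) / 2).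
  move: (expR _) (expR (_ / 2)) => *; nra.
have gk : 0 <= gamma / K%:R by rewrite divr_ge0 ?ler0n // ltW.
move: (expR (- (eta * d))) (expR (- (eta * z))) w0 e1 e4 => e w w0 e1 e4.
have we0 : 0 < w * e by nra.
have : (1 - gamma) * w / (K%:R - 1 + w) <=
    4 * ((1 - gamma) * (w * e) / (K%:R - 1 + w * e)).
  have -> : 4 * ((1 - gamma) * (w * e) / (K%:R - 1 + w * e)) =
     (1 - gamma) * (4 * (w * e) / (K%:R - 1 + w * e)).
    by rewrite !mulrA [4 * _]mulrC -!mulrA.
  rewrite -mulrA ler_wpM2l ?subr_ge0 // ler_pdivrMr; last by lra.
  rewrite mulrAC ler_pdivlMr; last by lra.
  have : 0 <= w * (K%:R - 1) * (4 * e - 1) by rewrite !mulr_ge0 //; lra.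
  have : 0 <= w * (w * e) by rewrite mulr_ge0 // ltW.
  lra.
move: (gamma / K%:R) gk => gk gk0; lra.
Qed.

Lemma solo_round z b v (F : play_state R K -> R) :
  \sum_M est_prob gamma eta (solo z) M *
    F (play_next gamma eta i0 i1 (solo z, 0, b) (fun j => if j == i1 then v else 0) M) =
  (1 - solo_prob z) * F (solo z, 0, b + v)
  + solo_prob z * F (solo (z + v / solo_prob z), 0, b + v).
Proof.
have sp := est_prob_sum gamma eta K_gt0 (solo z).
rewrite (bigD1 i1) //= in sp; rewrite (bigD1 i1) //= addrC; congr (_ + _).
  have -> : 1 - solo_prob z = \sum_(M | M != i1) est_prob gamma eta (solo z) M.
    by rewrite -sp est_prob_solo addrC addrK.
  rewrite mulr_suml; apply: eq_bigr => M /negbTE Mi.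
  by rewrite /play_next /= Mi est_step0 (negbTE i01) eqxx addr0.
rewrite est_prob_solo /play_next /= (negbTE i01) eqxx addr0.
congr (_ * F (_, _, _)); apply/funext => j.
by rewrite /est_step /solo; case: eqP => // _; rewrite -/(solo z) est_prob_solo.
Qed.

(** [A] is the excess aimed at, [r] the variance growth per round, [L] a cap on [eta * z] and [S]
    the time limit of exploration. [S_large] makes this limit long enough, [S_small] leaves enough
    rounds to punish, and [gamma_r] and [r_A] ensure variance [r] once [i1] is rare. *)
Context (T : nat) (A r L S : R).
Hypotheses (A_ge1 : 1 <= A) (r_ge0 : 0 <= r) (rL_le : 12 * r * L <= A).
Hypotheses (gamma_r : 2 * gamma * (1 + r) <= 1) (r_A : 1 + r <= 3 * A).
Hypotheses (L_large : 6 * A <= expR (L - 1)) (S_large : 16 * A ^+ 2 <= r * S).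
Hypothesis (S_small : gap_bound R K * (7 * K%:R * A + S + 1) <= T%:R - S - 1).
Hypothesis (gap_A : gap_bound R K + K%:R <= A / 2).
Hypotheses (eta_A : 1 <= eta * A).

Let A_gt0 : 0 < A := lt_le_trans ltr01 A_ge1.

Local Notation psi := (explore_potential A r L eta).
(** Scales the potential, at most [16 * K%:R ^+ 2 * A] at an upward exit, below the [A / 2] that
    punishment secures. *)
Local Notation kappa := ((40 * K%:R ^+ 2)^-1).

(** The lower bound on [solo_prob z] limits the next jump of the estimate to [6 * K%:R * A]. *)
Definition explorable (n : nat) (s : play_state R K) : Prop :=
  let z := s.1.1 i1 in let b := s.2 in let t := T%:R - n%:R in
  [/\ s = (solo z, 0, b), 0 <= z, 0 <= b <= t, - A < z - b < A &
      t < S /\ 1 <= 6 * K%:R * A * solo_prob z].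

Definition explore_value (n : nat) (s : play_state R K) : R :=
  kappa * psi (T%:R - n%:R) (s.1.1 i1) s.2.

(* The three arguments correspond to charging i1, charging nobody, and charging
   everybody but i1; the adversary plays the best one. *)
Definition adversary_potential (n : nat) (s : play_state R K) : R :=
  Num.max (if `[< explorable n s >] then explore_value n s else idle_value eta s)
          (Num.max (idle_value eta s) (punish_value i1 n s)).

Lemma idle_value_solo_ge0 z b : 0 <= z -> idle_value eta (solo z, 0, b) >= 0.
Proof.
move=> z0; rewrite /idle_value /= subr_ge0.
have : Num.min 0 b <= 0 :> R by rewrite ge_min lexx.
move=> /le_trans; apply; rewrite /est_mix divr_ge0 ?(ltW eta_gt0) // subr_ge0.
rewrite ler_ln ?posrE ?ltr0n ?est_weight_sum_gt0 //.
apply: le_trans (_ : \sum_(j < K) 1 <= _); last by rewrite sumr_const card_ord.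
apply: ler_sum => j _; rewrite /est_weight /solo -[leRHS]expR0 ler_expR oppr_le0.
by case: ifP => _; rewrite ?mulr0 // mulr_ge0 // ltW.
Qed.

(** More than [T - S - 1] rounds remain, enough for [rho ^+ n <= expR (- z)] to offset the gap sum,
    which is at most [K%:R * expR z]; the total loss is at most [K%:R + gap_bound R K]. *)
Lemma punish_value_up n z b : 0 <= b <= T%:R - n%:R -> T%:R - n%:R < S + 1 ->
  A <= z - b <= 7 * K%:R * A -> A / 2 <= punish_value i1 n (solo z, 0, b).
Proof.
move=> /andP[b0 bt] tS /andP[y1 y2].
have B1 := gap_bound_ge1 R K_gt0.
have B0 : 0 < gap_bound R K by exact: lt_le_trans ltr01 B1.
rewrite /punish_value /= {1}/solo eqxx.
set rho := 1 - _; set B := gap_bound R K in B0 B1 rho *.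
have rho0 : 0 <= rho by rewrite subr_ge0 invf_le1.
have rn : rho ^+ n <= expR (- (n%:R / B)).
  have -> : - (n%:R / B) = n%:R * - B^-1 by rewrite mulrN.
  by rewrite expRM_natl lerXn2r ?nnegrE ?expR_ge0 //; exact: expR_ge1Dx.
have Zz : gap_sum i1 (solo z) <= K%:R * expR z.
  apply: le_trans (_ : \sum_(j < K) expR z <= _); last first.
    by rewrite sumr_const card_ord mulr_natl.
  apply: ler_sum => j _; rewrite ler_expR /solo eqxx lerBlDr.
  have := A_gt0; case: ifP => _ ?; lra.
have Z0 : 0 <= gap_sum i1 (solo z) by apply: sumr_ge0 => j _; exact: expR_ge0.
have zn : z <= n%:R / B.
  rewrite ler_pdivlMr // mulrC.
  have H : B * z <= B * (7 * K%:R * A + S + 1) by rewrite ler_wpM2l ?(ltW B0) //; lra.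
  have := S_small; rewrite -/B; lra.
have rZ : rho ^+ n * gap_sum i1 (solo z) <= K%:R.
  apply: le_trans (ler_pM (exprn_ge0 _ rho0) Z0 rn Zz) _.
  rewrite mulrCA -expRD ler_piMr ?ler0n // -[leRHS]expR0 ler_expR; lra.
have rB : 0 <= rho ^+ n * B by rewrite mulr_ge0 ?exprn_ge0 // ltW.
have := gap_A; rewrite -/B mulrBr; lra.
Qed.

Lemma kappa_gt0 : 0 < kappa :> R.
Proof. by rewrite invr_gt0 mulr_gt0 // exprn_gt0 // ltr0n. Qed.

(** After an upward exit punishment is worth more; after a downward exit or at the time limit the
    potential is at most 0, hence below the idle value; otherwise exploration goes on. *)
Lemma explore_value_le n z b :
  0 <= z -> 0 <= b <= T%:R - n%:R -> T%:R - n%:R < S + 1 ->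
  - A - 1 <= z - b <= 7 * K%:R * A ->
  (z - b < A -> 1 <= 6 * K%:R * A * solo_prob z) ->
  explore_value n (solo z, 0, b) <= adversary_potential n (solo z, 0, b).
Proof.
move=> z0 bt tS /andP[y1 y2] pz; have k0 := kappa_gt0.
have t0 : 0 <= T%:R - n%:R :> R by case/andP: bt => b0; exact: le_trans.
have sz : solo z i1 = z by rewrite /solo eqxx.
have A0 := A_gt0.
have idle_le : psi (T%:R - n%:R) z b <= 0 ->
    explore_value n (solo z, 0, b) <= adversary_potential n (solo z, 0, b).
  move=> psi0; apply: le_trans (_ : idle_value eta (solo z, 0, b) <= _).
    apply: le_trans (idle_value_solo_ge0 b z0).
    by rewrite /explore_value /= sz pmulr_rle0.
  by rewrite /adversary_potential !le_max lexx orbT.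
have [yA|yA] := leP A (z - b).
  apply: le_trans (_ : punish_value i1 n (solo z, 0, b) <= _); last first.
    by rewrite /adversary_potential !le_max lexx !orbT.
  apply: le_trans (punish_value_up bt tS _); last by rewrite yA.
  rewrite /explore_value /= sz.
  have yy : 0 <= z - b <= 7 * K%:R * A by rewrite y2 andbT; lra.
  have := explore_potential_up eta A_ge1 r_ge0 rL_le k_ge2 t0 yy.
  rewrite -(ler_pM2l k0) => /le_trans; apply.
  rewrite mulrC ler_pdivrMr; last by rewrite -invr_gt0.
  have : 0 <= K%:R ^+ 2 * A by rewrite mulr_ge0 ?sqr_ge0 // ltW.
  lra.
have [yA'|yA'] := leP (z - b) (- A).
  apply: idle_le; apply: explore_potential_down => //.
  by rewrite y1.
have [tS'|tS'] := leP S (T%:R - n%:R).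
  apply: idle_le; apply: explore_potential_timeout => //; last by rewrite !ltW.
  by apply: le_trans S_large _; rewrite ler_wpM2l.
rewrite /adversary_potential; case: asboolP => [_|[]]; first by rewrite le_max lexx.
by rewrite /explorable /= sz yA yA'; split=> //; split=> //; exact: pz.
Qed.

Lemma explore_value_step n s : explorable n.+1 s ->
  exists v : 'I_K -> R, (forall j, 0 <= v j <= 1) /\
    explore_value n.+1 s <=
      \sum_M est_prob gamma eta s.1.1 M *
        adversary_potential n (play_next gamma eta i0 i1 s v M).
Proof.
move: s => [[x a] b]; rewrite /explorable /=.
set z := x i1; move=> [[-> ->] z0 /andP[b0 bt] /andP[y1 y2] [tS pA]].
have [p0 p1 _] := solo_prob_bounds z.
have A0 := A_gt0; have A1 := A_ge1; have k2 := k_ge2; have eA := eta_A.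
have e0 := eta_gt0; have r0 := r_ge0; have [g0 g1] := andP gamma01.
set p := solo_prob z in p0 p1 pA *.
pose q := Num.max (2 * gamma) (3 * A)^-1.
(* Above q, costs p / eta shrink the weight of i1 by a factor at most e, so p
   cannot drop far below q.  Below q, either p >= gamma / K has the order of q, or
   a single play of i1 raises z - b by 3 A and ends the exploration. *)
pose v := if p <= q then 1 else Num.min 1 (p / eta).
have v0 : 0 < v.
  rewrite /v; case: ifP => // _; rewrite lt_min ltr01 /=; exact: divr_gt0.
have v1 : v <= 1.
  by rewrite /v; case: ifP => // _; rewrite ge_min lexx.
have d0 : 0 < v / p by exact: divr_gt0.
have vE : v = p * (v / p) by rewrite mulrC divfK ?gt_eqF.
have vP : (v = 1 /\ (p <= 2 * gamma \/ p <= (3 * A)^-1)) \/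
    [/\ v = Num.min 1 (p / eta), 2 * gamma < p & (3 * A)^-1 < p].
  rewrite /v; case: (leP p q); rewrite /q ?le_max ?gt_max.
    by move=> /orP; left.
  by move=> /andP[]; right.
move: v v0 v1 d0 vE vP => {q} v v0 v1 d0 vE vP.
have [d dE] : exists d, d = v / p by exists (v / p).
rewrite -dE in d0 vE *.
have dA : d <= 6 * K%:R * A.
  by rewrite dE ler_pdivrMr //; apply: le_trans pA.
have kA : 2 * A <= K%:R * A by rewrite ler_pM2r.
have tE : T%:R - n%:R = T%:R - n.+1%:R + 1 :> R by rewrite -natr1; ring.
set t := T%:R - n.+1%:R in bt tS tE.
have A3 : (3 * A)^-1 * A = 1 / 3 by field; rewrite gt_eqF.
exists (fun j => if j == i1 then v else 0); split.
  by move=> j; case: ifP => _; rewrite ?lexx ?ler01 // v1 ltW.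
rewrite (solo_round z b v (adversary_potential n)) -/p -dE.
apply: le_trans (_ : (1 - p) * explore_value n (solo z, 0, b + v) +
   p * explore_value n (solo (z + d), 0, b + v) <= _); last first.
  apply: lerD.
    apply: ler_wpM2l; first by rewrite subr_ge0.
    by apply: explore_value_le; rewrite ?tE //; lra.
  apply: ler_wpM2l; first exact: ltW.
  apply: explore_value_le; rewrite ?tE //; try lra.
  move=> ydA.
  have [_ _ pk] := solo_prob_bounds (z + d).
  suff : (6 * A)^-1 <= K%:R * solo_prob (z + d).
    rewrite -[_^-1]mul1r ler_pdivrMr; last by lra.
    by lra.
  have A6 : (6 * A)^-1 = (3 * A)^-1 / 2 by field; rewrite gt_eqF.
  case: vP => [[v1E [pg|p3]]|[vq _ q3]].
  - have gA : (3 * A)^-1 <= 2 * gamma \/ p <= (3 * A)^-1.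
      by case: (leP p (3 * A)^-1); [right | left; lra].
    case: gA => [gA|p3]; last first.
      have : 3 * A <= d by rewrite dE v1E ler_pdivlMr // -ler_pdivlMl ?mulr1 //; lra.
      by lra.
    rewrite ler_pdivrMr in pk; last by lra.
    by rewrite A6; lra.
  - have : 3 * A <= d by rewrite dE v1E ler_pdivlMr // -ler_pdivlMl ?mulr1 //; lra.
    by lra.
  - have de : eta * d <= 1.
      rewrite dE vq mulrA ler_pdivrMr // mul1r mulrC -ler_pdivlMr //.
      by rewrite ge_min lexx orbT.
    have := solo_prob_drop z (ltW d0) de; rewrite -/p A6.
    set p' := solo_prob _ => H1.
    have : 2 * p' <= K%:R * p' by rewrite ler_wpM2r //; lra.
    lra.
rewrite /explore_value /= /solo eqxx tE -/t.
have -> : b + v = b + p * d by rewrite -vE.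
rewrite [leRHS](_ : _ = kappa * ((1 - p) * psi (t + 1) z (b + p * d)
  + p * psi (t + 1) (z + d) (b + p * d))); last by ring.
rewrite ler_pM2l ?kappa_gt0 //.
apply: explore_potential_step => //.
have mono : Num.min (eta * z) L <= Num.min (eta * (z + d)) L.
  rewrite le_min ge_min [in X in _ && X]ge_min lexx orbT andbT.
  by rewrite ler_pM2l // lerDl ltW.
case: vP => [[v1E pq]|[vq q2 q3]].
  (* At cost 1 the variance grows by [1 / p - 1 >= r], and the term in [L] can only increase. *)
  have dp : d = p^-1 by rewrite dE v1E mul1r.
  have pr : p * (1 + r) <= 1.
    case: pq => [pg|pA3].
      apply: le_trans gamma_r; rewrite ler_wpM2r //; lra.
    apply: le_trans (_ : (3 * A)^-1 * (3 * A) <= _); last by rewrite mulVf // gt_eqF //; lra.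
    by apply: ler_pM => //; lra.
  have -> : p * (1 - p) * d ^+ 2 = p^-1 - 1 by rewrite dp; field; rewrite gt_eqF.
  have : 1 + r <= p^-1 by rewrite -[p^-1]mul1r ler_pdivlMr // mulrC.
  have : 0 <= 3 * A * r * p * (Num.min (eta * (z + d)) L - Num.min (eta * z) L).
    by rewrite mulr_ge0 ?subr_ge0 // !mulr_ge0 // ltW.
  lra.
have de : eta * d <= 1.
  rewrite dE vq mulrA ler_pdivrMr // mul1r mulrC -ler_pdivlMr //.
  by rewrite ge_min lexx orbT.
(* Here [expR (- (eta * z)) >= p - gamma > p / 2], so the cap [L] is not exceeded even after a jump,
   as [eta * d <= 1]. *)
have zL : eta * z <= L - 1.
  rewrite -ler_expR; apply: le_trans L_large.
  have := solo_prob_le z; rewrite -/p => pw.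
  have : (6 * A)^-1 <= expR (- (eta * z)).
    have -> : (6 * A)^-1 = (3 * A)^-1 / 2 by field; rewrite gt_eqF.
    lra.
  by rewrite expRN lef_pV2 ?posrE ?expR_gt0 //; lra.
have -> : Num.min (eta * z) L = eta * z by apply/min_idPl; lra.
have -> : Num.min (eta * (z + d)) L = eta * z + eta * d.
  by rewrite mulrDr; apply/min_idPl; lra.
have ev : 1 <= 3 * A * (eta * v).
  rewrite vq; case: (leP 1 (p / eta)) => _; first by lra.
  rewrite [eta * _]mulrC divfK ?gt_eqF // mulrC -ler_pdivrMr; last by lra.
  by rewrite mul1r ltW.
have -> : 3 * A * r * p * (eta * z + eta * d - eta * z) = r * (3 * A * (eta * v)).
  by rewrite [in RHS]vE; ring.
have : r * 1 <= r * (3 * A * (eta * v)) by exact: ler_wpM2l.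
have : 0 <= p * (1 - p) * d ^+ 2.
  by rewrite mulr_ge0 ?sqr_ge0 // mulr_ge0 ?subr_ge0 // ltW.
lra.
Qed.

Lemma adversary_potential_step n s :
  exists v : 'I_K -> R, (forall j, 0 <= v j <= 1) /\
    adversary_potential n.+1 s <=
      \sum_M est_prob gamma eta s.1.1 M *
        adversary_potential n (play_next gamma eta i0 i1 s v M).
Proof.
have p0 j := est_prob_gt0 eta K_gt0 gamma01 s.1.1 j.
have idleP : exists v : 'I_K -> R, (forall j, 0 <= v j <= 1) /\
    idle_value eta s <= \sum_M est_prob gamma eta s.1.1 M *
        adversary_potential n (play_next gamma eta i0 i1 s v M).
  exists (fun=> 0); split=> [j|]; first by rewrite lexx ler01.
  rewrite -[leLHS]mul1r -(est_prob_sum gamma eta K_gt0 s.1.1) mulr_suml.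
  apply: ler_sum => M _; apply: ler_wpM2l; first exact: ltW.
  rewrite -(idle_value_step gamma eta i0 i1 s M).
  by rewrite /adversary_potential !le_max lexx orbT.
have punishP : exists v : 'I_K -> R, (forall j, 0 <= v j <= 1) /\
    punish_value i1 n.+1 s <= \sum_M est_prob gamma eta s.1.1 M *
        adversary_potential n (play_next gamma eta i0 i1 s v M).
  exists (punish_cost R i1); split=> [j|].
    by rewrite /punish_cost; case: eqP; rewrite ?lexx ?ler01.
  apply: le_trans (punish_value_step i0 i1 K_gt0 gamma01 eta_gt0 n s) _.
  apply: ler_sum => M _; apply: ler_wpM2l; first exact: ltW.
  by rewrite /adversary_potential !le_max lexx !orbT.
rewrite {1}/adversary_potential.
have maxP (a b c : R) : Num.max a (Num.max b c) = a \/ Num.max a (Num.max b c) = b \/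
    Num.max a (Num.max b c) = c.
  by case: (leP b c) => _; [case: (leP a c) | case: (leP a b)]; auto.
case: asboolP => [/explore_value_step exploreP|_].
  by have [->|[->|->]] := maxP (explore_value n.+1 s) (idle_value eta s) (punish_value i1 n.+1 s).
by have [->|[->|->]] := maxP (idle_value eta s) (idle_value eta s) (punish_value i1 n.+1 s).
Qed.

Lemma adaptive_adversary_regret : 0 < S ->
  exists c : schedule R K, cost_schedule c /\
    kappa * (A / 2) - gamma * T%:R <= exp3_expected_regret gamma eta c T.
Proof.
move=> S0; have A0 := A_gt0; have A1 := A_ge1; have k2 := k_ge2.
have S0' := S_small; have B1 := gap_bound_ge1 R K_gt0.
have endP s : adversary_potential 0 s <= est_mix eta s.1.1 - Num.min s.1.2 s.2.
  rewrite /adversary_potential !ge_max -/(idle_value eta s) lexx.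
  rewrite (punish_value_end i1 K_gt0 eta_gt0) andbT.
  case: asboolP => [H|_]; last by rewrite lexx.
  (* Exploring with no round left would mean [T%:R < S], against [S_small]. *)
  exfalso; move: H; rewrite /explorable /= => -[_ _ _ _ [TS _]].
  rewrite subr0 in TS.
  have : 0 <= gap_bound R K * (7 * K%:R * A + S + 1).
    by rewrite mulr_ge0 // ?addr_ge0 ?mulr_ge0 //; lra.
  lra.
have [c [c01 Hc]] := adversary_value K_gt0 gamma01 eta_gt0 T adversary_potential_step endP.
exists c; split=> //; apply: le_trans Hc; rewrite lerD2r.
have solo0 : solo 0 = fun=> 0 by apply/funext => j; rewrite /solo if_same.
rewrite /play_start -solo0.
apply: le_trans (_ : explore_value T (solo 0, 0, 0) <= _).
  rewrite /explore_value /= /solo eqxx subrr /explore_potential subr0 !mulr0.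
  rewrite ler_pM2l ?kappa_gt0 // expr2 !mulr0 subr0 !add0r lerDr.
  rewrite divr_ge0 //; last by lra.
  rewrite mulr_ge0 // ?mulr_ge0 //; first by lra.
  rewrite le_min lexx /=.
  have : 0 < L - 1 by rewrite -expR_gt1; apply: lt_le_trans L_large; lra.
  lra.
apply: explore_value_le; rewrite ?subrr ?lexx ?subr0 //; try lra.
  by apply/andP; split; [lra | rewrite !mulr_ge0 // ltW].
move=> _; have -> : solo_prob 0 = K%:R^-1.
  rewrite /solo_prob mulr0 oppr0 expR0 subrK; field.
  by rewrite gt_eqF //; lra.
have -> : 6 * K%:R * A * K%:R^-1 = 6 * A by field; rewrite gt_eqF //; lra.
by lra.
Qed.

End Explore.

(** * Choice of parameters and conclusion *)

Lemma scale_bounds (R : realType) (k u : R) : 2 <= k -> 100 * 200 * k ^+ 2 <= u ->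
  [/\ 0 < u, 12 * (128 * k ^+ 2 * u ^+ 2) * (1 + 8 * u) <= u ^+ 4,
      1 + 128 * k ^+ 2 * u ^+ 2 <= 256 * k ^+ 2 * u ^+ 2,
      256 * k ^+ 2 * u ^+ 2 <= u ^+ 4 &
      100 * k ^+ 3 <= u ^+ 2].
Proof.
move=> k2 ku; have kk : 2 * k <= k ^+ 2 by rewrite expr2 ler_wpM2r //; lra.
have u1 : 100 <= u by lra.
have u0 : 0 < u by lra.
have u20 : 0 < u ^+ 2 by rewrite exprn_gt0.
have H1 : 100 * 200 * k ^+ 2 * u ^+ 3 <= u ^+ 4.
  by rewrite [u ^+ 4]exprS ler_pM2r // exprn_gt0.
have H2 : 100 * (k ^+ 2 * u ^+ 2) <= k ^+ 2 * u ^+ 3.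
  have -> : k ^+ 2 * u ^+ 3 = u * (k ^+ 2 * u ^+ 2) by ring.
  by rewrite ler_wpM2r // mulr_ge0 ?sqr_ge0.
have H3 : 4 * 1 <= k ^+ 2 * u ^+ 2.
  apply: ler_pM => //; first by lra.
  by rewrite exprn_ege1 //; lra.
split=> //.
- have -> : 12 * (128 * k ^+ 2 * u ^+ 2) * (1 + 8 * u) =
    12 * 128 * (k ^+ 2 * u ^+ 2) + 12 * 128 * 8 * (k ^+ 2 * u ^+ 3) by ring.
  lra.
- lra.
- lra.
- apply: le_trans (_ : u * k <= _).
    rewrite exprSr mulrA ler_pM2r //; lra.
  by rewrite expr2 ler_wpM2l //; lra.
Qed.

(** The adaptive case takes [A = u ^+ 4], [r = 128 * k ^+ 2 * u ^+ 2], [L = 1 + 8 * u] and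
    [S = T%:R / (8 * k ^+ 2)]. *)
Lemma regret_lower_bound (R : realType) (K T : nat) (gamma eta u : R) :
  (2 <= K)%N -> 0 < gamma <= 1 -> 0 < eta ->
  100 * 200 * K%:R ^+ 2 <= u -> u ^+ 6 = T%:R ->
  exists c : schedule R K, cost_schedule c /\
    (512 * K%:R ^+ 3)^-1 * u ^+ 4 <= exp3_expected_regret gamma eta c T.
Proof.
move=> K2 gamma01 eta0 ku uT; set k : R := K%:R.
have k2 : 2 <= k by rewrite ler_nat.
have [u0 rL r1 rA ku2] := scale_bounds k2 ku.
pose i0 := Ordinal (ltnW K2); pose i1 := Ordinal K2.
have i01 : i0 != i1 by [].
have k0 : 0 < k by lra.
have [k20 k30 u20 A0] : [/\ 0 < k ^+ 2, 0 < k ^+ 3, 0 < u ^+ 2 & 0 < u ^+ 4].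
  by rewrite !exprn_gt0.
have k3 : 8 <= k ^+ 3.
  have -> : 8 = 2 * 2 * 2 :> R by ring.
  by rewrite !exprS expr0 mulr1 mulrA !ler_pM // mulr_ge0.
have n512 : 0 < 512 :> R by rewrite ltr0n.
have [d2 d3] := (mulr_gt0 n512 k20, mulr_gt0 n512 k30).
have d4 := mulr_gt0 d2 u20.
have k23 : 2 * k ^+ 2 <= k ^+ 3 by rewrite [k ^+ 3]exprS ler_pM2r.
have kk2 : 2 * k <= k ^+ 2 by rewrite expr2 ler_pM2r.
have AE : u ^+ 4 = u ^+ 2 * u ^+ 2 by rewrite -exprD.
have TE : T%:R = u ^+ 4 * u ^+ 2 :> R by rewrite -uT -exprD.
have Ak : 100 * k ^+ 3 <= u ^+ 4.
  by rewrite AE (le_trans ku2) // ler_peMl ?(ltW u20) //; lra.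
have [gl|gs] := leP (512 * k ^+ 2 * u ^+ 2)^-1 gamma.
  exists (one_bad_arm R i1); split; first exact: one_bad_arm_cost.
  apply: le_trans (one_bad_arm_exploration eta (ltnW K2) gamma01 i01 T).
  rewrite -/k TE.
  apply: le_trans (_ : (512 * k ^+ 2 * u ^+ 2)^-1 / k * (u ^+ 4 * u ^+ 2) <= _).
    by rewrite le_eqVlt; apply/orP; left; apply/eqP; field; rewrite !gt_eqF.
  by rewrite (ler_pM2r (mulr_gt0 A0 u20)) ler_pM2r ?invr_gt0.
have [eA|eA] := leP 1 (eta * u ^+ 4); last first.
  exists (one_bad_arm R i1); split; first exact: one_bad_arm_cost.
  (* About half of [u ^+ 4 < 1 / eta], so that [eta * N%:R ^+ 2 <= N%:R / 2]. *)
  pose N := Num.trunc (u ^+ 4 / 2).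
  have /andP[N1 N2] : N%:R <= u ^+ 4 / 2 < N.+1%:R.
    by apply: truncn_itv; rewrite divr_ge0 // ltW.
  have NT : (N <= T)%N.
    rewrite -(ler_nat R) TE; apply: le_trans N1 _.
    by rewrite ler_pM2l //; lra.
  apply: le_trans (one_bad_arm_slow_learning (ltnW K2) gamma01 eta0 i01 NT).
  rewrite -/k; rewrite -[N.+1%:R]natr1 in N2.
  have eN : eta * N%:R <= 1 / 2.
    apply: le_trans (_ : eta * (u ^+ 4 / 2) <= _); first by rewrite ler_pM2l.
    lra.
  have eN2 : eta * N%:R ^+ 2 <= 1 / 2 * N%:R by rewrite expr2 mulrA ler_wpM2r.
  rewrite ler_pdivlMr // [_ * _ * k]mulrAC.
  have -> : (512 * k ^+ 3)^-1 * k = (512 * k ^+ 2)^-1.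
    by field; rewrite gt_eqF.
  apply: le_trans (_ : 1 / 8 * u ^+ 4 <= _); last first.
    lra.
  rewrite (ler_pM2r A0) -[leLHS]mul1r (ler_pdivrMr _ _ d2).
  lra.
have gr : 2 * gamma * (1 + 128 * k ^+ 2 * u ^+ 2) <= 1.
  have gu : gamma * (512 * k ^+ 2 * u ^+ 2) <= 1.
    by rewrite -(ler_pdivlMr _ _ d4) mul1r; exact: ltW.
  have [g0 _] := andP gamma01.
  have : gamma * (1 + 128 * k ^+ 2 * u ^+ 2) <= gamma * (256 * k ^+ 2 * u ^+ 2).
    by rewrite (ler_pM2l g0).
  lra.
have A1 : 1 <= u ^+ 4 by lra.
have r0 : 0 <= 128 * k ^+ 2 * u ^+ 2 by rewrite !mulr_ge0 ?ltW.
(* [expR (8 * u)] is the fourth power of [expR (2 * u) >= 2 * u]. *)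
have L_large : 6 * u ^+ 4 <= expR (1 + 8 * u - 1).
  have -> : 1 + 8 * u - 1 = 4%:R * (2 * u) by ring.
  rewrite expRM_natl.
  apply: le_trans (_ : (2 * u) ^+ 4 <= _).
    by rewrite exprMn -natrX (ler_pM2r A0) ler_nat.
  rewrite lerXn2r ?nnegrE ?expR_ge0 ?mulr_ge0 ?(ltW u0) //.
  have := expR_ge1Dx (2 * u); lra.
(* Makes [r * S] equal to [16 * A ^+ 2], while [gap_bound R K * S] is only [T%:R / 4]. *)
pose S := u ^+ 6 / (8 * k ^+ 2).
have S0 : 0 < S by rewrite divr_gt0 ?exprn_gt0 ?mulr_gt0.
have SE : 8 * (k ^+ 2 * S) = u ^+ 4 * u ^+ 2.
  by rewrite /S uT TE; field; rewrite gt_eqF.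
have S_large : 16 * u ^+ 4 ^+ 2 <= 128 * k ^+ 2 * u ^+ 2 * S.
  have -> : 128 * k ^+ 2 * u ^+ 2 * S = 16 * u ^+ 2 * (8 * (k ^+ 2 * S)) by ring.
  by rewrite SE le_eqVlt; apply/orP; left; apply/eqP; ring.
have S32 : 4 * S <= k ^+ 2 * S by rewrite (ler_pM2r S0); lra.
have S_small : gap_bound R K * (7 * K%:R * u ^+ 4 + S + 1) <= T%:R - S - 1.
  rewrite /gap_bound -/k TE.
  have : 100 * k ^+ 3 * u ^+ 4 <= u ^+ 4 * u ^+ 2 by rewrite mulrC (ler_pM2l A0).
  have : k ^+ 3 * 1 <= k ^+ 3 * u ^+ 4 by rewrite (ler_pM2l k30).
  have -> : 2 * k ^+ 2 * (7 * k * u ^+ 4 + S + 1) =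
    14 * (k ^+ 3 * u ^+ 4) + 2 * (k ^+ 2 * S) + 2 * k ^+ 2 by ring.
  rewrite -mulrA.
  move: (u ^+ 4 * u ^+ 2) (k ^+ 3 * u ^+ 4) (k ^+ 2 * S) SE S32 => x y w *; lra.
have gap_A : gap_bound R K + K%:R <= u ^+ 4 / 2 by rewrite /gap_bound -/k; lra.
have r3A : 1 + 128 * k ^+ 2 * u ^+ 2 <= 3 * u ^+ 4 by lra.
have [c [c01 cR]] := adaptive_adversary_regret K2 gamma01 eta0 i01 A1 r0 rL gr r3A
  L_large S_large S_small gap_A eA S0.
exists c; split=> //; apply: le_trans cR; rewrite -/k TE.
have gT : gamma * (u ^+ 4 * u ^+ 2) <= (512 * k ^+ 2)^-1 * u ^+ 4.
  have -> : (512 * k ^+ 2)^-1 * u ^+ 4 = (512 * k ^+ 2 * u ^+ 2)^-1 * (u ^+ 4 * u ^+ 2).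
    by field; rewrite !gt_eqF.
  by rewrite (ler_pM2r (mulr_gt0 A0 u20)); exact: ltW.
have kV : (512 * k ^+ 3)^-1 <= (512 * k ^+ 2)^-1.
  by rewrite (lef_pV2 (x := 512 * k ^+ 3) d3 d2); lra.
(* In units of [(512 * k ^+ 2)^-1 * u ^+ 4], the gain is 6.4 and exploration loses at most 1. *)
have -> : (40 * k ^+ 2)^-1 * (u ^+ 4 / 2) = 512 / 80 * ((512 * k ^+ 2)^-1 * u ^+ 4).
  by field; rewrite gt_eqF.
have : (512 * k ^+ 3)^-1 * u ^+ 4 <= (512 * k ^+ 2)^-1 * u ^+ 4.
  by rewrite (ler_pM2r A0).
have : 0 <= (512 * k ^+ 2)^-1 * u ^+ 4.
  by apply: ltW; apply: mulr_gt0 A0; rewrite invr_gt0.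
move: ((512 * k ^+ 2)^-1 * u ^+ 4) (_ * u ^+ 4) gT => x y *; lra.
Qed.

Theorem theorem1p2 (R : realType) (K : nat) (hK : (2 <= K)%N)
    (eta gamma : nat -> R)
    (heta : forall T : nat, 0 < eta T)
    (hgamma : forall T : nat, 0 < gamma T <= 1) :
  exists c : nat -> schedule R K,
    (forall T : nat, cost_schedule (c T)) /\
    (exists (a : R) (T0 : nat),
       0 < a /\
       forall T : nat, (T0 <= T)%N ->
         a * (T%:R `^ (2 / 3)) <=
         exp3_expected_regret (gamma T) (eta T) (c T) T).
Proof.
pose U : R := 100 * 200 * K%:R ^+ 2.
have U0 : 0 <= U by rewrite mulr_ge0 ?sqr_ge0.
(* [T0 <= T] gives [U ^+ 6 <= T%:R], so the sixth root of [T%:R] is at least [U]. *)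
pose T0 := (Num.trunc (U ^+ 6)).+1.
have bound T : exists c : schedule R K, cost_schedule c /\
    ((T0 <= T)%N -> (512 * K%:R ^+ 3)^-1 * T%:R `^ (2 / 3) <=
      exp3_expected_regret (gamma T) (eta T) c T).
  have [TT|TT] := leqP T0 T; last first.
    by exists (fun _ _ => 0); split=> // h j; rewrite lexx ler01.
  pose u : R := T%:R `^ 6^-1.
  have u6 : u ^+ 6 = T%:R.
    by rewrite -powR_mulrn ?powR_ge0 // -powRrM mulVf // powRr1.
  have u4 : u ^+ 4 = T%:R `^ (2 / 3).
    by rewrite -powR_mulrn ?powR_ge0 // -powRrM; congr (_ `^ _); field.
  have Uu : U <= u.
    rewrite -(ler_pXn2r (n := 6)) ?nnegrE ?powR_ge0 // u6.
    by rewrite (le_trans (ltW (truncnS_gt _))) // ler_nat.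
  have [c [c01 cR]] := regret_lower_bound hK (hgamma T) (heta T) Uu u6.
  by exists c; split=> // _; rewrite -u4.
have [c cP] := choice bound.
exists c; split=> [T|]; first by case: (cP T).
exists (512 * K%:R ^+ 3)^-1, T0; split; last by move=> T; case: (cP T).
have K0 : 0 < K%:R :> R by rewrite ltr0n ltnW.
have n512 : 0 < 512 :> R by rewrite ltr0n.
by rewrite invr_gt0 (mulr_gt0 n512) // exprn_gt0.
Qed.
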